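(* If $G=(X,Y;E)$ is a bipartite graph (without multiple edges) with maximum degree $\Delta(G)$, then $$\chi'_{int}(G,X) \leq \frac{(\Delta(G))^2(\Delta(G)+1)}{2}.$$
   Context: For a bipartite graph $G$ with parts $X$ and $Y$, an $X$-interval coloring is a proper edge coloring of $G$ by integers such that, for every vertex $x\in X$, the set of colors on the edges incident to $x$ forms an interval of consecutive integers. $\chi'_{int}(G,X)$ denotes the smallest integer $t$ such that $G$ has an $X$-interval coloring using $t$ colors (every bipartite graph has one, e.g. with $|E(G)|$ colors). *)

(* Defs.v *)
From mathcomp Require Import all_boot all_order all_algebra.
From mathcomp Require Import boolp zify.

Set Implicit Arguments.
Unset Strict Implicit.
Unset Printing Implicit Defensive.

Import Order.TTheory GRing.Theory Num.Theory.

(* A finite bipartite graph without multiple edges G = (X, Y; E) is given by   *)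
(* its two parts X, Y : finType and its edge set E : {set X * Y}.              *)

Definition edges_at_l (X Y : finType) (E : {set X * Y}) (x : X) : {set X * Y} :=
  [set e in E | e.1 == x].

Definition edges_at_r (X Y : finType) (E : {set X * Y}) (y : Y) : {set X * Y} :=
  [set e in E | e.2 == y].

Definition max_degree (X Y : finType) (E : {set X * Y}) : nat :=
  maxn (\max_(x : X) #|edges_at_l E x|) (\max_(y : Y) #|edges_at_r E y|).

(* An edge coloring is a function c : X * Y -> int, of which only the values   *)
(* on E are ever considered.                                                   *)
Definition proper_edge_coloring (X Y : finType) (E : {set X * Y})
    (c : X * Y -> int) : Prop :=
  forall e f : X * Y, e \in E -> f \in E -> e <> f ->
    e.1 = f.1 \/ e.2 = f.2 -> c e <> c f.

(* Taking b < a gives the empty interval, so isolated vertices of X impose no  *)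
(* condition.                                                                  *)
Definition interval_at (X Y : finType) (E : {set X * Y})
    (c : X * Y -> int) (x : X) : Prop :=
  exists a b : int, forall k : int,
    (exists2 e, e \in edges_at_l E x & c e = k) <-> (a <= k <= b)%R.

Definition X_interval_coloring (X Y : finType) (E : {set X * Y})
    (c : X * Y -> int) : Prop :=
  proper_edge_coloring E c /\ forall x : X, interval_at E c x.

Definition num_colors (X Y : finType) (E : {set X * Y}) (c : X * Y -> int) : nat :=
  size (undup [seq c e | e <- enum E]).

Definition has_X_interval_coloring (X Y : finType) (E : {set X * Y})
    (t : nat) : Prop :=
  exists c : X * Y -> int, X_interval_coloring E c /\ num_colors E c = t.

Lemma X_interval_coloring_exists (X Y : finType) (E : {set X * Y}) :
  exists t : nat, `[< has_X_interval_coloring E t >].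
Proof.
pose N x := [seq y <- enum Y | (x, y) \in E].
pose c (e : X * Y) : nat := enum_rank e.1 * #|Y| + index e.2 (N e.1).
have NE x y : (y \in N x) = ((x, y) \in E) by rewrite mem_filter mem_enum andbT.
have sN x : size (N x) <= #|Y|.
  by rewrite size_filter (leq_trans (count_size _ _)) // -cardE.
have idx x y : (x, y) \in E -> index y (N x) < size (N x).
  by rewrite index_mem NE.
exists (num_colors E (fun e => Posz (c e))); apply/asboolP.
exists (fun e => Posz (c e)); split=> //; split.
  move=> [x y] [x' y'] eE fE ne _ [] /eqP; rewrite /c /= => /eqP h.
  have i1 := leq_trans (idx _ _ eE) (sN x).
  have i2 := leq_trans (idx _ _ fE) (sN x').
  have Y0 : 0 < #|Y| by apply: leq_trans i1.
  have /ord_inj/enum_rank_inj xx : nat_of_ord (enum_rank x) = enum_rank x'.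
    by have := congr1 (divn^~ #|Y|) h; rewrite !divnMDl // !divn_small // !addn0.
  subst x'; move/addnI: h => h; apply: ne; congr pair.
  by rewrite -(nth_index y (s := N x) (x := y)) ?NE // h nth_index ?NE.
move=> x; exists (Posz (enum_rank x * #|Y|)).
exists (Posz (enum_rank x * #|Y| + size (N x)) - 1)%R => k; split.
  case=> -[x' y]; rewrite inE /= => /andP[eE /eqP xx] <-; subst x'.
  by rewrite /c /=; have := idx _ _ eE; lia.
case: k => k hk; last by lia.
have hi : k - enum_rank x * #|Y| < size (N x) by lia.
have [y0 _] : exists y : Y, true by case: (N x) hi => // y ? _; exists y.
exists (x, nth y0 (N x) (k - enum_rank x * #|Y|)).
  by rewrite inE /= eqxx andbT -NE mem_nth.
have uN : uniq (N x) by rewrite filter_uniq ?enum_uniq.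
rewrite /c /= index_uniq //; congr Posz; apply: subnKC; by case/andP: hk.
Qed.

Definition chi_int (X Y : finType) (E : {set X * Y}) : nat :=
  ex_minn (X_interval_coloring_exists E).

(* Main.v *)
Require Import Defs.
From mathcomp Require Import all_boot all_order all_algebra.
From mathcomp Require Import boolp zify.

(** Let [D] be the maximum degree. Colour the vertices of [X] greedily, one at a
    time, giving a vertex [x] of degree [d] one of the aligned intervals
    [k d, ..., k d + d - 1] with [k < D], and distributing its colours over the
    edges of [x] by one of the [d] cyclic shifts. This leaves [d D] options.
    Each neighbour of [x] has at most [D - 1] other edges, and the colour of
    such an edge rules out exactly one pair (interval, shift). Hence at most
    [d (D - 1) < d D] options are excluded, and the colours [0, ..., D^2 - 1]
    suffice, which is even better than the stated bound. *)

Set Implicit Arguments.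
Unset Strict Implicit.
Unset Printing Implicit Defensive.

(* The option [p] encodes the interval [p %/ d] and the shift [p %% d]. *)
Definition shift_color (d i p : nat) : nat := p %/ d * d + (i + p) %% d.

Lemma shift_color_div d i p : 0 < d -> shift_color d i p %/ d = p %/ d.
Proof.
by move=> d0; rewrite /shift_color divnMDl // [X in _ + X]divn_small ?ltn_mod ?addn0.
Qed.

Lemma shift_color_mod d i p : shift_color d i p %% d = (i + p) %% d.
Proof. by rewrite /shift_color modnMDl modn_mod. Qed.

(** The quotient of the colour by [d] recovers the interval, and its residue recovers the shift
    because [i] is fixed. Hence a forbidden colour on one edge excludes at most one option. *)
Lemma shift_color_inj d i : 0 < d -> injective (shift_color d i).
Proof.
move=> d0 p q h.
have hd : p %/ d = q %/ d by rewrite -(shift_color_div i p) // h shift_color_div.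
have /eqP : i + p = i + q %[mod d] by rewrite -shift_color_mod h shift_color_mod.
rewrite eqn_modDl => /eqP hm.
by rewrite (divn_eq p d) hd hm -divn_eq.
Qed.

Lemma shift_color_index_inj d p i j :
  i < d -> j < d -> shift_color d i p = shift_color d j p -> i = j.
Proof.
move=> id jd h.
have /eqP : i + p = j + p %[mod d] by rewrite -shift_color_mod h shift_color_mod.
by rewrite eqn_modDr !modn_small // => /eqP.
Qed.

Lemma shift_color_lt d i p m : p < d * m -> shift_color d i p < m * d.
Proof.
move=> pm; have d0 : 0 < d by case: d pm.
by rewrite -ltn_divLR // shift_color_div // ltn_divLR // mulnC.
Qed.

Lemma shift_color_surj d p c :
  0 < d -> p %/ d * d <= c < p %/ d * d + d ->
  exists2 i, i < d & shift_color d i p = c.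
Proof.
move=> d0 /andP[lo hi]; set j := c - p %/ d * d.
have jd : j < d by rewrite /j; lia.
(* Undo the rotation: this is [j - p] modulo [d], with [d - p %% d] in place of [- p] to avoid
   truncated subtraction. *)
exists ((j + (d - p %% d)) %% d); first by rewrite ltn_mod.
rewrite /shift_color modnDml -addnA.
have -> : d - p %% d + p = (p %/ d).+1 * d.
  by have := ltn_pmod p d0; have := divn_eq p d; lia.
by rewrite [j + _]addnC modnMDl modn_small // /j subnKC.
Qed.

Section BipartiteGraph.

Variables (X Y : finType) (E : {set X * Y}).

Let deg x := #|edges_at_l E x|.
Let D := max_degree E.

Definition edge_index (e : X * Y) : nat := index e (enum (edges_at_l E e.1)).

Definition shift_coloring (p : X -> nat) (e : X * Y) : nat :=
  shift_color #|edges_at_l E e.1| (edge_index e) (p e.1).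

Lemma deg_l_le x : #|edges_at_l E x| <= max_degree E.
Proof. by rewrite leq_max (leq_bigmax (F := fun x => #|edges_at_l E x|)). Qed.

Lemma deg_r_le y : #|edges_at_r E y| <= max_degree E.
Proof.
by rewrite leq_max (leq_bigmax (F := fun y => #|edges_at_r E y|)) orbT.
Qed.

Lemma edge_index_lt e : e \in E -> edge_index e < #|edges_at_l E e.1|.
Proof. by move=> eE; rewrite cardE index_mem mem_enum inE eE eqxx. Qed.

Lemma edge_index_inj e f :
  e \in E -> f \in E -> e.1 = f.1 -> edge_index e = edge_index f -> e = f.
Proof.
move=> eE fE h; rewrite /edge_index -h => /(congr1 (nth e (enum (edges_at_l E e.1)))).
by rewrite !nth_index // mem_enum inE ?eE ?fE ?h eqxx.
Qed.

(** A member [f] determines the edge at [x] that it meets, namely [(x, f.2)], so storing [f] alone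
    suffices. *)
Definition conflict_edges (x : X) : {set X * Y} :=
  \bigcup_(e in edges_at_l E x) (edges_at_r E e.2 :\ e).

Lemma conflict_edgesP x x' y :
  (x, y) \in E -> (x', y) \in E -> x != x' -> (x', y) \in conflict_edges x.
Proof.
move=> xy x'y ne; apply/bigcupP; exists (x, y); first by rewrite inE xy eqxx.
by rewrite !inE x'y eqxx xpair_eqE eq_sym (negPf ne).
Qed.

(** Union bound: removing [e] itself leaves at most [D - 1] edges at its endpoint in [Y]. *)
Lemma card_conflict_edges x :
  #|conflict_edges x| <= #|edges_at_l E x| * (max_degree E).-1.
Proof.
rewrite -sum_nat_const; apply: (@leq_trans
    (\sum_(e in edges_at_l E x) #|edges_at_r E e.2 :\ e|)).
  apply: (big_ind2 (fun (A : {set X * Y}) n => #|A| <= n)) => //.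
    by rewrite cards0.
  move=> A m B n hA hB; apply: leq_trans (leq_add hA hB).
  by rewrite cardsU leq_subr.
apply: leq_sum => e; rewrite inE => /andP[eE _].
have := cardsD1 e (edges_at_r E e.2); have := deg_r_le e.2.
by rewrite inE eE eqxx /=; lia.
Qed.

(* If every option were excluded, choosing a conflicting edge for each option
   would inject the [deg x * D] options into [conflict_edges x]. *)
Lemma free_option (x : X) (c : X * Y -> nat) : 0 < deg x ->
  exists2 q, q < deg x * D & forall x' y, (x, y) \in E -> (x', y) \in E ->
    x != x' -> shift_color (deg x) (edge_index (x, y)) q <> c (x', y).
Proof.
move=> d0; have D0 : 0 < D by apply: leq_trans d0 (deg_l_le x).
pose bad (q : 'I_(deg x * D)) e := (e \in conflict_edges x) &&
  (shift_color (deg x) (edge_index (x, e.2)) q == c e).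
have [/forallP allbad|] := boolP [forall q, exists e, bad q e]; last first.
  rewrite negb_forall => /existsP[q]; rewrite negb_exists => /forallP hq.
  exists q => // x' y xy x'y ne h; have := hq (x', y).
  by rewrite /bad conflict_edgesP //= h eqxx.
have fP q : {e | bad q e} by apply: sigW; apply/existsP.
have finj : injective (fun q => sval (fP q)).
  (* Two options blocked by the same edge [f] give [(x, f.2)] the same colour, so they coincide. *)
  move=> q q' h; case/andP: (svalP (fP q)); case/andP: (svalP (fP q')).
  rewrite -h => _ /eqP <- _ /eqP /(shift_color_inj d0); exact: val_inj.
have : deg x * D <= #|conflict_edges x|.
  rewrite -[X in X <= _]card_ord -cardsT -(card_imset _ finj).
  apply: subset_leq_card; apply/subsetP => _ /imsetP[q _ ->].
  by case/andP: (svalP (fP q)).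
move/leq_trans/(_ (card_conflict_edges x)); rewrite leq_pmul2l //.
by rewrite leqNgt ltn_predL D0.
Qed.

(** Induction on [s]: the new vertex takes an option that is free with respect to the colouring by
    the old [p], whose values on the tail stay unchanged. *)
Lemma greedy_options (s : seq X) : uniq s -> exists p : X -> nat,
  (forall x, x \in s -> 0 < deg x -> p x < deg x * D) /\
  (forall x x' y, x \in s -> x' \in s -> (x, y) \in E -> (x', y) \in E ->
     x != x' -> shift_coloring p (x, y) <> shift_coloring p (x', y)).
Proof.
elim: s => [|x s IHs] /=; first by exists (fun=> 0).
case/andP=> xs /IHs[p [pD pP]].
have [q qD qP] : exists2 q, (0 < deg x -> q < deg x * D) &
    forall x' y, (x, y) \in E -> (x', y) \in E -> x != x' ->
    shift_color (deg x) (edge_index (x, y)) q <> shift_coloring p (x', y).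
  have [d0|d0] := posnP (deg x); last first.
    by have [q qD qP] := free_option (shift_coloring p) d0; exists q.
  (* An isolated vertex has no edge to colour, so its option is a dummy. *)
  exists 0; first by rewrite d0.
  by move=> x' y xy; have := edge_index_lt xy; rewrite -/(deg x) d0.
exists (fun z => if z == x then q else p z); split.
  move=> z; rewrite inE; case: eqP => [-> _ //|_ /=]; exact: pD.
have ne_x z : z \in s -> (z == x) = false.
  by move=> zs; apply: contraNF xs => /eqP <-.
move=> z z' y; rewrite !inE /shift_coloring /=.
case/orP=> [/eqP->|zs]; case/orP=> [/eqP->|z's] zy z'y ne.
- by rewrite eqxx in ne.
- by rewrite eqxx (ne_x z') //; apply: qP.
- by rewrite eqxx (ne_x z) //; apply/nesym/qP; rewrite // eq_sym.
- by rewrite !ne_x //; apply: pP.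
Qed.

(** A cyclic shift only permutes the colours of the chosen block, so any [p] works. *)
Lemma shift_coloring_interval p x : interval_at E (Posz \o shift_coloring p) x.
Proof.
have [d0|d0] := posnP (deg x).
  exists 1%R, 0%R => k; split; last by lia.
  by case=> e; rewrite (cards0_eq d0) inE.
pose a := p x %/ deg x * deg x; exists (Posz a), (Posz (a + deg x) - 1)%R => k.
split.
  case=> e; rewrite inE => /andP[_ /eqP ex] <- /=.
  rewrite /shift_coloring /shift_color ex -/(deg x) -/a.
  by have := ltn_pmod (edge_index e + p x) d0; lia.
case: k => k hk; last by lia.
have [|i id ik] := @shift_color_surj (deg x) (p x) k d0; first by lia.
have [e0 _] : exists e : X * Y, e \in edges_at_l E x by apply/card_gt0P.
pose e := nth e0 (enum (edges_at_l E x)) i.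
have ex : e \in edges_at_l E x by rewrite -mem_enum mem_nth // -cardE.
exists e => //=; have /eqP e1 : e.1 == x by move: ex; rewrite inE => /andP[].
rewrite /shift_coloring /edge_index e1 index_uniq ?enum_uniq -?cardE //.
by rewrite -/(deg x) ik.
Qed.

Lemma chi_int_le_sqr : chi_int E <= max_degree E ^ 2.
Proof.
have [p [pD pP]] := greedy_options (enum_uniq X).
have {}pD x : 0 < deg x -> p x < deg x * D by apply: pD; rewrite mem_enum.
pose c := Posz \o shift_coloring p.
have cP : X_interval_coloring E c.
  split=> [|x]; last exact: shift_coloring_interval.
  move=> e f eE fE ne adj [] cef.
  (* Edges with a common endpoint in [X] differ by their index; those meeting only in [Y] differ by
     the greedy choice. *)
  have [e1|e1] := eqVneq e.1 f.1.
    apply: ne; apply: edge_index_inj => //.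
    move: cef; rewrite /shift_coloring -e1; apply: shift_color_index_inj.
      exact: edge_index_lt.
    by rewrite e1 edge_index_lt.
  case: adj => [h|h]; first by rewrite h eqxx in e1.
  case: e f h e1 eE fE cef {ne} => [x y] [x' y'] /= <- ne xy x'y.
  by apply: pP; rewrite ?mem_enum.
apply: (@leq_trans (num_colors E c)).
  by rewrite /chi_int; case: ex_minnP => m _; apply; apply/asboolP; exists c.
(* Count the colours by embedding them in [0, ..., D^2 - 1]; each is below [D * deg e.1]. *)
rewrite -[X in _ <= X](size_iota 0) -(size_map Posz).
apply: uniq_leq_size; first exact: undup_uniq.
move=> k; rewrite mem_undup => /mapP[e]; rewrite mem_enum => eE ->.
apply: map_f; rewrite mem_iota /= add0n.
have d0 : 0 < deg e.1 by apply: leq_trans (edge_index_lt eE).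
apply: leq_trans (shift_color_lt _ (pD _ d0)) _.
by rewrite expnS expn1 leq_mul2l deg_l_le orbT.
Qed.

End BipartiteGraph.

Theorem theorem2p4 (X Y : finType) (E : {set X * Y}) :
  ((chi_int E)%:R <=
     (max_degree E)%:R ^+ 2 * ((max_degree E)%:R + 1) / 2 :> rat)%R.
Proof.
have h : (chi_int E).*2 <= max_degree E ^ 2 * (max_degree E).+1.
  (* For positive maximum degree, the factor 2 is at most the degree plus one; for degree 0 both
     sides vanish. *)
  have := chi_int_le_sqr E; case: (max_degree E) => [|D] h; first by lia.
  by rewrite -muln2; apply: leq_mul.
rewrite Num.Theory.ler_pdivlMr // -[1%R]/(1%:R)%R -[2%R]/(2%:R)%R.
by rewrite -GRing.natrX -GRing.natrD -!GRing.natrM Num.Theory.ler_nat muln2 addn1.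
Qed.
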